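(* Let $X$ be a real normed linear space and let $x,y\in X$ be nonzero vectors. If $p\geq 1$, then $$s_{\geq 1}(p)\leq d_{\geq 1}(p)\leq k_{\geq 1}(p)\leq \alpha_p[x,y]\leq K_{\geq 1}(p)=D_{\geq 1}(p)\leq S_{\geq 1}(p),$$ while for $p<1$ ($p\in\mathbb{R}$), $$s_{<1}(p)\leq d_{<1}(p)=k_{<1}(p)\leq \alpha_p[x,y]\leq K_{<1}(p)\leq D_{<1}(p)\leq S_{<1}(p).$$
   Context: For $p\in\mathbb{R}$ and nonzero $x,y\in X$, the $p$-angular distance is $\alpha_p[x,y]=\big\|\,\|x\|^{p-1}x-\|y\|^{p-1}y\,\big\|$. For fixed nonzero $x,y$, write $m=\min\{\|x\|,\|y\|\}$, $M=\max\{\|x\|,\|y\|\}$, and define $D_{\geq 1}(p)=\|x-y\|\,m^{p-1}+\big|\|x\|^{p-1}-\|y\|^{p-1}\big|\,M$, $D_{<1}(p)=\|x-y\|\,M^{p-1}+\big|\|x\|^{p-1}-\|y\|^{p-1}\big|\,M$, $S_{\geq 1}(p)=\|x-y\|\,M^{p-1}+\big|\|x\|^{p-1}-\|y\|^{p-1}\big|\,m$, $S_{<1}(p)=\|x-y\|\,m^{p-1}+\big|\|x\|^{p-1}-\|y\|^{p-1}\big|\,m$, $d_{\geq 1}(p)=\|x-y\|\,M^{p-1}-\big|\|x\|^{p-1}-\|y\|^{p-1}\big|\,M$, $d_{<1}(p)=\|x-y\|\,m^{p-1}-\big|\|x\|^{p-1}-\|y\|^{p-1}\big|\,M$, $s_{\geq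 1}(p)=\|x-y\|\,m^{p-1}-\big|\|x\|^{p-1}-\|y\|^{p-1}\big|\,m$, $s_{<1}(p)=\|x-y\|\,M^{p-1}-\big|\|x\|^{p-1}-\|y\|^{p-1}\big|\,m$, $K_{\geq 1}(p)=k_{<1}(p)=\|x\|^{p}+\|y\|^{p}-(\|x\|+\|y\|-\|x-y\|)\,m^{p-1}$, $K_{<1}(p)=k_{\geq 1}(p)=\|x\|^{p}+\|y\|^{p}-(\|x\|+\|y\|-\|x-y\|)\,M^{p-1}$. The index of each quantity indicates the range of $p$ in which it is used. *)

(* Defs.v *)
From HB Require Import structures.
From mathcomp Require Import all_boot all_order all_algebra.
From mathcomp Require Import all_classical all_reals all_analysis.
Import Order.TTheory GRing.Theory Num.Theory.
Import numFieldNormedType.Exports.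

Set Implicit Arguments.
Unset Strict Implicit.
Unset Printing Implicit Defensive.

Local Open Scope ring_scope.

(* All quantities below are meant for nonzero x and y: [a `^ b] is
   exp (b ln a) for a > 0, while at a = 0 it takes a conventional value. *)
Section PAngularBounds.
Variables (R : realType) (X : normedModType R).
Implicit Types (p : R) (x y : X).

Definition p_angular_dist p x y : R :=
  `| (`|x| `^ (p - 1)) *: x - (`|y| `^ (p - 1)) *: y |.

Definition min_norm x y : R := Num.min `|x| `|y|.
Definition max_norm x y : R := Num.max `|x| `|y|.

Definition pow_gap p x y : R :=
  `| `|x| `^ (p - 1) - `|y| `^ (p - 1) |.

Definition D_ge1 p x y : R :=
  `|x - y| * min_norm x y `^ (p - 1) + pow_gap p x y * max_norm x y.
Definition D_lt1 p x y : R :=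
  `|x - y| * max_norm x y `^ (p - 1) + pow_gap p x y * max_norm x y.

Definition S_ge1 p x y : R :=
  `|x - y| * max_norm x y `^ (p - 1) + pow_gap p x y * min_norm x y.
Definition S_lt1 p x y : R :=
  `|x - y| * min_norm x y `^ (p - 1) + pow_gap p x y * min_norm x y.

Definition d_ge1 p x y : R :=
  `|x - y| * max_norm x y `^ (p - 1) - pow_gap p x y * max_norm x y.
Definition d_lt1 p x y : R :=
  `|x - y| * min_norm x y `^ (p - 1) - pow_gap p x y * max_norm x y.

Definition s_ge1 p x y : R :=
  `|x - y| * min_norm x y `^ (p - 1) - pow_gap p x y * min_norm x y.
Definition s_lt1 p x y : R :=
  `|x - y| * max_norm x y `^ (p - 1) - pow_gap p x y * min_norm x y.

Definition K_ge1 p x y : R :=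
  `|x| `^ p + `|y| `^ p
  - (`|x| + `|y| - `|x - y|) * min_norm x y `^ (p - 1).
Definition K_lt1 p x y : R :=
  `|x| `^ p + `|y| `^ p
  - (`|x| + `|y| - `|x - y|) * max_norm x y `^ (p - 1).

Definition k_ge1 p x y : R := K_lt1 p x y.
Definition k_lt1 p x y : R := K_ge1 p x y.

End PAngularBounds.

(* Main.v *)
Require Import Defs.
From HB Require Import structures.
From mathcomp Require Import all_boot all_order all_algebra.
From mathcomp Require Import all_classical all_reals all_analysis.
From mathcomp Require Import ring lra.
Import Order.TTheory GRing.Theory Num.Theory.
Import numFieldNormedType.Exports.

Local Open Scope ring_scope.

(** Put [A = `|x| `^ (p - 1)], [B = `|y| `^ (p - 1)] and [d = `|x - y|]. The
    angular distance is the norm of [A *: x - B *: y], and this vector splits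
    off a multiple of [x - y] in two ways:
      [A *: x - B *: y = B *: (x - y) + (A - B) *: x
                       = A *: (x - y) + (A - B) *: y].
    The triangle inequality thus locates the distance within [`|A - B| * `|x|]
    of [B * d], and within [`|A - B| * `|y|] of [A * d]
    (lemma [norm_scale_sub_approx]).

    All the quantities are symmetric in [x] and [y], so one may assume
    [`|x| <= `|y|]. The sign of [A - B] is then that of [1 - p], and since
    [`|x| `^ p = `|x| * A] and [`|y| `^ p = `|y| * B], the bounds [k] and [K]
    are exactly two of the four bounds just obtained. The outer inequalities
    compare affine expressions: each difference of neighbours is
    [`|A - B| * (`|y| - `|x|)], which is nonnegative by the ordering,
    or [`|A - B| * (d - (`|y| - `|x|))], which is nonnegative by the reverse
    triangle inequality, or zero. *)

Lemma le0_ger_powR (R : realType) (r a b : R) :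
  r <= 0 -> 0 < a -> a <= b -> b `^ r <= a `^ r.
Proof.
move=> r_le0 a_gt0 le_ab; have b_gt0 := lt_le_trans a_gt0 le_ab.
rewrite -[r]opprK ![_ `^ (- - r)]powRN lef_pV2 ?posrE ?powR_gt0 //.
by apply: ge0_ler_powR; rewrite ?oppr_ge0 ?nnegrE // ltW.
Qed.

(** Comes from [A *: x - B *: y = B *: (x - y) + (A - B) *: x]; exchanging the
    two pairs [(A, x)] and [(B, y)] gives the estimate centred at
    [A * `|x - y|]. *)
Lemma norm_scale_sub_approx (R : realType) (X : normedModType R)
    (x y : X) (A B : R) : 0 <= B ->
  `|x - y| * B - `|A - B| * `|x| <= `|A *: x - B *: y|
    <= `|x - y| * B + `|A - B| * `|x|.
Proof.
move=> B_ge0.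
have -> : A *: x - B *: y = B *: (x - y) + (A - B) *: x.
  by rewrite scalerBr scalerBl [RHS]addrC addrA subrK.
have <- : `|B *: (x - y)| = `|x - y| * B by rewrite normrZ ger0_norm // mulrC.
by rewrite -normrZ lerB_normD ler_normD.
Qed.

Lemma p_angular_distC (R : realType) (X : normedModType R) (p : R) (x y : X) :
  p_angular_dist p x y = p_angular_dist p y x.
Proof. exact: distrC. Qed.

Lemma min_normC (R : realType) (X : normedModType R) (x y : X) :
  min_norm x y = min_norm y x.
Proof. exact: minC. Qed.

Lemma max_normC (R : realType) (X : normedModType R) (x y : X) :
  max_norm x y = max_norm y x.
Proof. exact: maxC. Qed.

Lemma pow_gapC (R : realType) (X : normedModType R) (p : R) (x y : X) :
  pow_gap p x y = pow_gap p y x.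
Proof. exact: distrC. Qed.

Lemma K_ge1C (R : realType) (X : normedModType R) (p : R) (x y : X) :
  K_ge1 p x y = K_ge1 p y x.
Proof.
by rewrite /K_ge1 min_normC distrC [`|x| + _]addrC [`|x| `^ p + _]addrC.
Qed.

Lemma K_lt1C (R : realType) (X : normedModType R) (p : R) (x y : X) :
  K_lt1 p x y = K_lt1 p y x.
Proof.
by rewrite /K_lt1 max_normC distrC [`|x| + _]addrC [`|x| `^ p + _]addrC.
Qed.

Theorem theorem2 (R : realType) (X : normedModType R) (x y : X)
    (hx : x <> 0) (hy : y <> 0) (p : R) :
  (1 <= p ->
     s_ge1 p x y <= d_ge1 p x y /\
     d_ge1 p x y <= k_ge1 p x y /\
     k_ge1 p x y <= p_angular_dist p x y /\
     p_angular_dist p x y <= K_ge1 p x y /\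
     K_ge1 p x y = D_ge1 p x y /\
     D_ge1 p x y <= S_ge1 p x y) /\
  (p < 1 ->
     s_lt1 p x y <= d_lt1 p x y /\
     d_lt1 p x y = k_lt1 p x y /\
     k_lt1 p x y <= p_angular_dist p x y /\
     p_angular_dist p x y <= K_lt1 p x y /\
     K_lt1 p x y <= D_lt1 p x y /\
     D_lt1 p x y <= S_lt1 p x y).
Proof.
rewrite /k_ge1 /k_lt1 /D_ge1 /D_lt1 /S_ge1 /S_lt1 /d_ge1 /d_lt1 /s_ge1 /s_lt1.
wlog le_xy : x y hx hy / `|x| <= `|y|.
  move=> ordered; have [|/ltW le_yx] := leP `|x| `|y|; first exact: ordered.
  rewrite p_angular_distC min_normC max_normC pow_gapC K_ge1C K_lt1C distrC.
  exact: ordered.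
have x_gt0 : 0 < `|x| by rewrite normr_gt0; apply/eqP.
have y_gt0 : 0 < `|y| by rewrite normr_gt0; apply/eqP.
have pow_pred (a : R) : 0 < a -> a `^ p = a * a `^ (p - 1).
  by move=> a_gt0; rewrite -{2}[a]powRr1 ?ltW // -powRD ?subrKC // (gt_eqF a_gt0) implybT.
have rev_triangle : `|y| - `|x| <= `|x - y| by rewrite distrC lerB_dist.
rewrite /K_ge1 /K_lt1 /p_angular_dist /pow_gap /min_norm /max_norm.
rewrite (min_idPl le_xy) (max_idPr le_xy) !pow_pred //.
have A_ge0 := powR_ge0 `|x| (p - 1); have B_ge0 := powR_ge0 `|y| (p - 1).
have le_pow : 1 <= p -> `|x| `^ (p - 1) <= `|y| `^ (p - 1).
  by move=> p_ge1; apply: ge0_ler_powR; rewrite ?subr_ge0 ?nnegrE.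
have ge_pow : p < 1 -> `|y| `^ (p - 1) <= `|x| `^ (p - 1).
  by move=> p_lt1; apply: le0_ger_powR; rewrite // subr_le0 ltW.
move: A_ge0 B_ge0 le_pow ge_pow.
move: (`|x| `^ (p - 1)) (`|y| `^ (p - 1)) => A B A_ge0 B_ge0 le_pow ge_pow.
have /andP[lower_B upper_B] := norm_scale_sub_approx _ _ x y A B B_ge0.
have /andP[lower_A upper_A] := norm_scale_sub_approx _ _ y x B A A_ge0.
rewrite [`|y - x|]distrC [`|B - A|]distrC [`|B *: y - _|]distrC
  in lower_A upper_A.
(* Only degree-two products remain: the gap times [`|y| - `|x|] and the gap
   times [`|x - y| - (`|y| - `|x|)] account for every outer inequality. *)
split=> [/le_pow le_AB | /ge_pow le_BA].
- have gapE : `|A - B| = B - A by rewrite distrC ger0_norm ?subr_ge0.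
  rewrite gapE in lower_A upper_A lower_B upper_B *.
  by do ![split]; nra.
- have gapE : `|A - B| = A - B by rewrite ger0_norm ?subr_ge0.
  rewrite gapE in lower_A upper_A lower_B upper_B *.
  by do ![split]; nra.
Qed.
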